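(* Let $ABC$ be a triangle and $P$ a point not on the extended sides of $ABC$ or of its anticomplementary triangle. The map $\textsf{M}=T_PK^{-1}T_{P'}$ is a homothety or translation taking the conic $\tilde{\mathcal{C}}_O$ to the inconic $\mathcal{I}$, which is the conic with center $Q$ tangent to the sides $BC,CA,AB$ of $ABC$ at the points $D,E,F$.
   Context: We work in the Euclidean plane extended by the line at infinity $l_\infty$; affine maps act on the extended plane; juxtaposition of maps is composition. A homothety may have any nonzero real ratio. Products of lines such as $AP\cdot BC$ denote intersection points. The center of a conic is the pole of $l_\infty$ with respect to it. $ABC$ is a triangle with centroid $G$; $D_0,E_0,F_0$ are the midpoints of $BC,CA,AB$. $K$ is the complement map, the homothety with center $G$ and ratio $-1/2$; $K^{-1}(ABC)$ is the anticomplementary triangle. $P$ is a point (ordinary or infinite) not on the extended sides of $ABC$ or $K^{-1}(ABC)$. $D=AP\cdot BC$, $E=BP\cdot CA$, $F=CP\cdot AB$ are its traces. $D_3,E_3,F_3$ are the reflections of $D,E,F$ in $D_0,E_0,F_0$; the lines $AD_3,BE_3,CF_3$ concur in $P'=\iota(P)$, the isotomic conjugate of $P$ (in barycentric coordinates $\iota(x:y:z)=(1/x:1/y:1/z)$). $Q=K(P')$. $T_P$ and $T_{P'}$ are the unique affine maps taking $A,B,C$ to $D,E,F$ and to $D_3,E_3,F_3$, respectively. The nine-point conic $\mathcal{N}_{P'}$ of the quadrangle $ABCP'$ with respect to $l_\infty$ is the locus of centers of the conics through $A,B,C,P'$, the center of a degenerate conic (pair of opposite sides) being the intersection of its two lines;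 it passes through the diagonal points $D_3,E_3,F_3$ and the midpoints of the six sides. $\tilde{\mathcal{C}}_O=T_{P'}^{-1}(\mathcal{N}_{P'})$; it is a circumconic of $ABC$ with center $O=T_{P'}^{-1}K(Q)$ (the generalized circumcenter of $P$). *)

(* Defs.v *)
From HB Require Import structures.
From mathcomp Require Import all_boot all_order all_algebra.
From mathcomp Require Import boolp classical_sets reals.
Set Implicit Arguments.
Unset Strict Implicit.
Unset Printing Implicit Defensive.
Import GRing.Theory.
Local Open Scope classical_set_scope.
Local Open Scope ring_scope.

(* The Euclidean plane is 'rV[R]_2.  Its extension by the line at infinity is
   the projective plane of 'rV[R]_(2 + 1): extended points are the subspaces of
   dimension 1 and lines those of dimension 2, so that incidence is inclusion,
   (p + q)%VS is the line joining p and q, and (l :&: m)%VS is the intersection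
   point of l and m. *)
Notation subspace R := {vspace 'rV[R]_(2 + 1)}.

Definition is_point (R : realType) (p : subspace R) : Prop := \dim p = 1%N.
Definition is_line (R : realType) (l : subspace R) : Prop := \dim l = 2%N.

Definition pt (R : realType) (X : 'rV[R]_2) : subspace R :=
  <[row_mx X 1%:M]>%VS.

(* The points of line_inf are the <[row_mx v 0]> with v != 0. *)
Definition line_inf (R : realType) : subspace R :=
  lker (linfun (@rsubmx R 1 2 1)).

Definition line_through (R : realType) (X Y : 'rV[R]_2) : subspace R :=
  (pt X + pt Y)%VS.

(* The affine map X |-> X *m lin + trans. *)
Record affmap (R : realType) :=
  Affmap { lin : 'M[R]_2; trans : 'rV[R]_2 }.

Definition aff_fun (R : realType) (f : affmap R) (X : 'rV[R]_2) : 'rV[R]_2 :=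
  X *m lin f + trans f.

Definition aff_comp (R : realType) (f g : affmap R) : affmap R :=
  Affmap (lin g *m lin f) (trans g *m lin f + trans f).

(* Meaningful only when lin f is invertible. *)
Definition aff_inv (R : realType) (f : affmap R) : affmap R :=
  Affmap (invmx (lin f)) (- (trans f *m invmx (lin f))).

(* Action on the extended plane: act f (pt X) = pt (aff_fun f X), and the
   infinite point <[row_mx v 0]> goes to <[row_mx (v *m lin f) 0]>. *)
Definition act (R : realType) (f : affmap R) (p : subspace R) : subspace R :=
  (linfun (mulmxr (block_mx (lin f) 0 (trans f) (1%:M : 'M[R]_1))) @: p)%VS.

Definition homothety (R : realType) (c : 'rV[R]_2) (k : R) : affmap R :=
  Affmap k%:M ((1 - k) *: c).

Definition translation (R : realType) (v : 'rV[R]_2) : affmap R :=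
  Affmap 1%:M v.

Definition is_homothety (R : realType) (f : affmap R) : Prop :=
  exists c k, k != 0 /\ f = homothety c k.

Definition is_translation (R : realType) (f : affmap R) : Prop :=
  exists v, f = translation v.

Definition triangle (R : realType) (A B C : 'rV[R]_2) : Prop :=
  free [:: B - A; C - A].

Definition off_sides (R : realType) (A B C : 'rV[R]_2) (P : subspace R) : Prop :=
  [/\ ~~ (P <= line_through B C)%VS,
      ~~ (P <= line_through C A)%VS &
      ~~ (P <= line_through A B)%VS].

Definition midpoint (R : realType) (X Y : 'rV[R]_2) : 'rV[R]_2 :=
  2^-1 *: (X + Y).

Definition centroid (R : realType) (A B C : 'rV[R]_2) : 'rV[R]_2 :=
  3^-1 *: (A + B + C).

Definition complement (R : realType) (A B C : 'rV[R]_2) : affmap R :=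
  homothety (centroid A B C) (- 2^-1).

Definition off_anticomplementary_sides (R : realType) (A B C : 'rV[R]_2)
    (P : subspace R) : Prop :=
  let Kinv := aff_fun (aff_inv (complement A B C)) in
  off_sides (Kinv A) (Kinv B) (Kinv C) P.

(* The trace of P on the side YZ opposite to the vertex X, i.e. XP . YZ *)
Definition trace (R : realType) (X Y Z : 'rV[R]_2) (P : subspace R) :
    subspace R :=
  ((pt X + P) :&: line_through Y Z)%VS.

(* The reflection of that trace in the midpoint of YZ *)
Definition refl_trace (R : realType) (X Y Z : 'rV[R]_2) (P : subspace R) :
    subspace R :=
  act (homothety (midpoint Y Z) (-1)) (trace X Y Z P).

(* The common point of AD_3, BE_3 and CF_3 *)
Definition isotomic (R : realType) (A B C : 'rV[R]_2) (P : subspace R) :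
    subspace R :=
  ((pt A + refl_trace A B C P) :&: (pt B + refl_trace B C A P)
     :&: (pt C + refl_trace C A B P))%VS.

(* A (possibly degenerate) conic is given by a nonzero symmetric matrix S; it is
   nondegenerate when S is invertible. *)
Definition conic_matrix (R : realType) (S : 'M[R]_(2 + 1)) : Prop :=
  S != 0 /\ S^T = S.

Definition conic_points (R : realType) (S : 'M[R]_(2 + 1)) : set (subspace R) :=
  [set X | is_point X /\ forall u, u \in X -> u *m S *m u^T = 0].

Definition is_pole (R : realType) (S : 'M[R]_(2 + 1)) (l X : subspace R) : Prop :=
  is_point X /\
  forall v, v \in l <-> (forall u, u \in X -> u *m S *m v^T = 0).

Definition line_pair (R : realType) (l m : subspace R) : set (subspace R) :=
  [set X | is_point X /\ ((X <= l)%VS \/ (X <= m)%VS)].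

(* The center is the pole of the line at infinity, or, for a pair of distinct
   lines, their intersection. *)
Definition is_center (R : realType) (S : 'M[R]_(2 + 1)) (X : subspace R) : Prop :=
  (S \in unitmx /\ is_pole S (line_inf R) X) \/
  (S \notin unitmx /\ exists l m,
     [/\ is_line l, is_line m, l <> m, conic_points S = line_pair l m
       & X = (l :&: m)%VS]).

Definition nine_point_conic (R : realType) (A B C : 'rV[R]_2) (P' : subspace R) :
    set (subspace R) :=
  [set X | exists S, [/\ conic_matrix S,
     [/\ conic_points S (pt A), conic_points S (pt B), conic_points S (pt C)
       & conic_points S P'] & is_center S X]].

Definition tangent_at (R : realType) (I : set (subspace R)) (l X : subspace R) :
    Prop :=
  I `&` [set Y | (Y <= l)%VS] = [set X].

(* I is a nondegenerate conic with center Q which is tangent to BC, CA, AB at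
   D, E, F. *)
Definition is_inconic (R : realType) (A B C : 'rV[R]_2) (Q D E F : subspace R)
    (I : set (subspace R)) : Prop :=
  (exists S, [/\ conic_matrix S, S \in unitmx, I = conic_points S
               & is_center S Q]) /\
  [/\ tangent_at I (line_through B C) D,
      tangent_at I (line_through C A) E &
      tangent_at I (line_through A B) F].

(* Main.v *)
Require Import Defs.
From HB Require Import structures.
From mathcomp Require Import all_boot all_order all_algebra.
From mathcomp Require Import boolp classical_sets reals.
From mathcomp Require Import ring lra zify.
Set Implicit Arguments.
Unset Strict Implicit.
Unset Printing Implicit Defensive.
Import GRing.Theory.
Local Open Scope classical_set_scope.
Local Open Scope ring_scope.

(* In barycentric coordinates P = (p : q : r) and P' = (qr : pr : pq).  The
   conics through A, B, C, P' are a yz + b zx + c xy = 0 with ap + bq + cr = 0.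
   The pole condition on a center (x : y : z) is linear in (a, b, c), and
   eliminating (a, b, c) shows that the nine-point conic is
     p x (y + z - x) + q y (z + x - y) + r z (x + y - z) = 0.
   Substituting the matrices of T_P and K^-1 turns it into the inconic
     X^2 + Y^2 + Z^2 = 2 (YZ + ZX + XY),  X = x / p, Y = y / q, Z = z / r.
   This conic is the only one touching the sides at D, E, F, because a binary
   quadratic form with a single zero is a multiple of a square.  On vectors
   with vanishing coordinate sum, the matrix of M is the scalar
   - 4 p q r / ((q + r) (r + p) (p + q)). *)

Definition row3 (R : realType) (x y z : R) : 'rV[R]_(2 + 1) :=
  \row_j [:: x; y; z]`_j.

(** The off-diagonal arguments come in the order yz, zx, xy, so that the conic a yz + b zx + c xy =
    0 has the matrix [sym3 0 0 0 a b c]. *)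
Definition sym3 (R : realType) (g00 g11 g22 g12 g02 g01 : R) :
    'M[R]_(2 + 1) :=
  \matrix_(i, j) (nth [::] [:: [:: g00; g01; g02];
                               [:: g01; g11; g12];
                               [:: g02; g12; g22]] i)`_j.

Definition det3 (R : realType) (g00 g11 g22 g12 g02 g01 : R) : R :=
  g00 * g11 * g22 + 2 * g12 * g02 * g01
  - g00 * g12 ^+ 2 - g11 * g02 ^+ 2 - g22 * g01 ^+ 2.

(** * Three-dimensional row vectors and symmetric matrices *)

Section Row3.
Context (R : realType).
Implicit Types (x y z : R) (G : 'M[R]_(2 + 1)).

Lemma forall_ord3 (T : 'I_(2 + 1) -> Prop) :
  T 0 -> T 1 -> T (inord 2) -> forall i, T i.
Proof.
move=> T0 T1 T2 [[|[|[|//]]] i3].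
- by rewrite (_ : Ordinal i3 = 0) //; apply: val_inj.
- by rewrite (_ : Ordinal i3 = 1) //; apply: val_inj.
- by rewrite (_ : Ordinal i3 = inord 2) //; apply: val_inj; rewrite /= inordK.
Qed.

Lemma sum_ord3 (V : nmodType) (F : 'I_(2 + 1) -> V) :
  \sum_i F i = F 0 + F 1 + F (inord 2).
Proof.
rewrite !big_ord_recl big_ord0 addr0 addrA.
by congr (_ + F _ + F _); apply: val_inj; rewrite /= ?inordK.
Qed.

Lemma row3_eta (u : 'rV[R]_(2 + 1)) : u = row3 (u 0 0) (u 0 1) (u 0 (inord 2)).
Proof.
by apply/rowP; apply: forall_ord3; rewrite !mxE //= inordK.
Qed.

Lemma row3P (u : 'rV[R]_(2 + 1)) : exists x y z, u = row3 x y z.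
Proof. by do 3!eexists; apply: row3_eta. Qed.

Lemma row3_inj x y z x' y' z' :
  row3 x y z = row3 x' y' z' -> [/\ x = x', y = y' & z = z'].
Proof.
move=> /rowP e; split.
- by have := e 0; rewrite !mxE.
- by have := e 1; rewrite !mxE.
- by have := e (inord 2); rewrite !mxE /= inordK.
Qed.

Lemma row3D x y z x' y' z' :
  row3 x y z + row3 x' y' z' = row3 (x + x') (y + y') (z + z').
Proof. by apply/rowP; apply: forall_ord3; rewrite !mxE //= inordK. Qed.

Lemma row3Z k x y z : k *: row3 x y z = row3 (k * x) (k * y) (k * z).
Proof. by apply/rowP; apply: forall_ord3; rewrite !mxE //= inordK. Qed.

Lemma row3_0 : row3 0 0 0 = 0 :> 'rV[R]_(2 + 1).
Proof. by apply/rowP; apply: forall_ord3; rewrite !mxE //= inordK. Qed.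

Lemma row3_mul x y z (n : nat) (G : 'M[R]_(2 + 1, n)) :
  row3 x y z *m G = x *: row 0 G + y *: row 1 G + z *: row (inord 2) G.
Proof.
by apply/rowP => j; rewrite !mxE sum_ord3 !mxE /= inordK.
Qed.

Lemma row3_sym3 x y z g00 g11 g22 g12 g02 g01 :
  row3 x y z *m sym3 g00 g11 g22 g12 g02 g01 =
  row3 (x * g00 + y * g01 + z * g02) (x * g01 + y * g11 + z * g12)
    (x * g02 + y * g12 + z * g22).
Proof.
rewrite row3_mul; apply/rowP; apply: forall_ord3;
  by rewrite !mxE /= !inordK.
Qed.

Lemma row3_dot x y z x' y' z' :
  row3 x y z *m (row3 x' y' z')^T = (x * x' + y * y' + z * z')%:M.
Proof.
apply/matrixP => i j; by rewrite !ord1 !mxE sum_ord3 !mxE /= inordK.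
Qed.

Lemma tr_sym3 (g00 g11 g22 g12 g02 g01 : R) :
  (sym3 g00 g11 g22 g12 g02 g01)^T = sym3 g00 g11 g22 g12 g02 g01.
Proof.
apply/matrixP => i j; rewrite !mxE; move: i j.
by apply: forall_ord3; apply: forall_ord3; rewrite /= ?inordK.
Qed.

Lemma sym3P G : G^T = G ->
  exists g00 g11 g22 g12 g02 g01, G = sym3 g00 g11 g22 g12 g02 g01.
Proof.
move=> sG; exists (G 0 0), (G 1 1), (G (inord 2) (inord 2)), (G 1 (inord 2)).
exists (G 0 (inord 2)), (G 0 1); apply/matrixP => i j.
have s i' j' : G i' j' = G j' i' by rewrite -{1}sG mxE.
rewrite !mxE; move: i j.
by apply: forall_ord3; apply: forall_ord3; rewrite /= ?inordK //= s.
Qed.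

Lemma sym3_inj0 (g00 g11 g22 g12 g02 g01 : R) :
  sym3 g00 g11 g22 g12 g02 g01 = 0 ->
  [/\ g00 = 0, g11 = 0 & g22 = 0] /\ [/\ g12 = 0, g02 = 0 & g01 = 0].
Proof.
move=> /matrixP e; split; split.
- by have := e 0 0; rewrite !mxE.
- by have := e 1 1; rewrite !mxE.
- by have := e (inord 2) (inord 2); rewrite !mxE /= inordK.
- by have := e 1 (inord 2); rewrite !mxE /= inordK.
- by have := e 0 (inord 2); rewrite !mxE /= inordK.
- by have := e 0 1; rewrite !mxE.
Qed.

Lemma det_sym3 (g00 g11 g22 g12 g02 g01 : R) :
  \det (sym3 g00 g11 g22 g12 g02 g01) = det3 g00 g11 g22 g12 g02 g01.
Proof.
rewrite (expand_det_row _ 0) !big_ord_recl big_ord0 /cofactor.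
rewrite !(expand_det_row _ 0) !big_ord_recl !big_ord0 /cofactor !det_mx11 !mxE.
rewrite /= /bump /= /det3.
ring.
Qed.

End Row3.

(** * Barycentric coordinates in a frame of the projective plane *)

Definition nonzero3 (R : realType) (x y z : R) : bool :=
  [|| x != 0, y != 0 | z != 0].

(* x, y and z are the barycentric coordinates in the frame given by the rows
   of W. *)
Definition bary (R : realType) (W : 'M[R]_(2 + 1)) (x y z : R) :
    'rV[R]_(2 + 1) :=
  row3 x y z *m W.

(* The line l x + m y + n z = 0, where (x : y : z) = u *m invmx W. *)
Definition bary_line (R : realType) (W : 'M[R]_(2 + 1)) (l m n : R) :
    subspace R :=
  lker (linfun (mulmxr (invmx W *m (row3 l m n)^T))).

Lemma bary_line_eq (R : realType) (W : 'M[R]_(2 + 1)) (a b c a' b' c' : R) :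
  a = a' -> b = b' -> c = c' -> bary_line W a b c = bary_line W a' b' c'.
Proof. by move=> -> -> ->. Qed.

Lemma bary_eq (R : realType) (W : 'M[R]_(2 + 1)) (x y z x' y' z' : R) :
  x = x' -> y = y' -> z = z' -> bary W x y z = bary W x' y' z'.
Proof. by move=> -> -> ->. Qed.

Lemma vline_bary_eq (R : realType) (W : 'M[R]_(2 + 1)) (x y z x' y' z' : R) :
  x = x' -> y = y' -> z = z' -> <[bary W x y z]>%VS = <[bary W x' y' z']>%VS.
Proof. by move=> -> -> ->. Qed.

Section Frame.
Context (R : realType) (W : 'M[R]_(2 + 1)).
Implicit Types (x y z : R) (S : 'M[R]_(2 + 1)) (p l m : subspace R).
Local Notation vec := (bary W).
Local Notation bline := (bary_line W).

(** A sum of real squares vanishes only if every term does. It serves below as a denominator that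
    requires no choice of a nonzero coordinate. *)
Lemma nonzero3P x y z : reflect (x ^+ 2 + y ^+ 2 + z ^+ 2 != 0) (nonzero3 x y z).
Proof.
rewrite /nonzero3; apply: (iffP idP) => [|h].
  by apply: contraTneq => e; rewrite !negb_or !negbK; apply/and3P; split;
    apply/eqP; nra.
apply: contraNT h; rewrite !negb_or !negbK => /and3P [/eqP-> /eqP-> /eqP->].
by apply/eqP; ring.
Qed.

Lemma vecD x y z x' y' z' :
  vec x y z + vec x' y' z' = vec (x + x') (y + y') (z + z').
Proof. by rewrite /bary -mulmxDl row3D. Qed.

Lemma vecZ k x y z : k *: vec x y z = vec (k * x) (k * y) (k * z).
Proof. by rewrite /bary -row3Z scalemxAl. Qed.

Lemma vec_rows x y z :
  vec x y z = x *: vec 1 0 0 + y *: vec 0 1 0 + z *: vec 0 0 1.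
Proof. by rewrite !vecZ !vecD; congr vec; ring. Qed.

Hypothesis W_unit : W \in unitmx.

Lemma vecP (u : 'rV[R]_(2 + 1)) : exists x y z, u = vec x y z.
Proof.
have [x [y [z e]]] := row3P (u *m invmx W).
by exists x, y, z; rewrite /bary -e mulmxKV.
Qed.

Lemma vec_inj x y z x' y' z' :
  vec x y z = vec x' y' z' -> [/\ x = x', y = y' & z = z'].
Proof. by move=> /(can_inj (mulmxK W_unit)) /row3_inj. Qed.

Lemma vec_eq0 x y z : (vec x y z == 0) = ~~ nonzero3 x y z.
Proof.
rewrite /nonzero3 !negb_or !negbK; apply/eqP/and3P.
  have -> : 0 = vec 0 0 0 by rewrite /bary row3_0 mul0mx.
  by move=> /vec_inj [-> -> ->]; rewrite eqxx.
by move=> [/eqP-> /eqP-> /eqP->]; rewrite /bary row3_0 mul0mx.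
Qed.

Lemma mem_bary_line x y z (a b c : R) :
  (vec x y z \in bline a b c) = (x * a + y * b + z * c == 0).
Proof.
rewrite memv_ker lfunE /= /bary mulmxA mulmxK // row3_dot.
by apply/eqP/eqP => [/matrixP /(_ 0 0)|->]; rewrite ?raddf0 // !mxE mulr1n.
Qed.

(** The three equations say that the cross product of the vectors v and w vanishes. The factor
    between them is (v.w)/(w.w), because (w.w) v - (v.w) w is the cross product of w with that of v
    and w. *)
Lemma vline_eq x y z x' y' z' :
  nonzero3 x y z -> nonzero3 x' y' z' ->
  y * z' = z * y' -> z * x' = x * z' -> x * y' = y * x' ->
  <[vec x y z]>%VS = <[vec x' y' z']>%VS.
Proof.
move=> h h' e1 e2 e3; apply/eqP.
rewrite eqEdim !dim_vline !vec_eq0 h h' leqnn andbT -memvE.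
apply/vlineP; exists ((x * x' + y * y' + z * z') / (x' ^+ 2 + y' ^+ 2 + z' ^+ 2)).
move/nonzero3P: h' => h'; rewrite vecZ; congr vec; rewrite mulrAC;
  apply: (mulIf h'); rewrite divfK //; apply: subr0_eq.
- transitivity (y' * (x * y' - y * x') - z' * (z * x' - x * z')); first ring.
  by rewrite e2 e3; ring.
- transitivity (z' * (y * z' - z * y') - x' * (x * y' - y * x')); first ring.
  by rewrite e1 e3; ring.
- transitivity (x' * (z * x' - x * z') - y' * (y * z' - z * y')); first ring.
  by rewrite e1 e2; ring.
Qed.

Lemma vline_inj x y z x' y' z' :
  <[vec x y z]>%VS = <[vec x' y' z']>%VS ->
  exists k, [/\ x = k * x', y = k * y' & z = k * z'].
Proof.
move=> e; have /vlineP [k] : vec x y z \in <[vec x' y' z']>%VS.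
  by rewrite -e memv_line.
by rewrite vecZ => /vec_inj [-> -> ->]; exists k.
Qed.

Lemma is_point_vline x y z : nonzero3 x y z -> is_point <[vec x y z]>%VS.
Proof. by move=> h; rewrite /is_point dim_vline vec_eq0 h. Qed.

Lemma is_pointP p : is_point p ->
  exists x y z, nonzero3 x y z /\ p = <[vec x y z]>%VS.
Proof.
move=> p1; have [x [y [z e]]] := vecP (vpick p).
have p0 : vpick p != 0 by rewrite vpick0 -dimv_eq0 p1.
exists x, y, z; move: (p0); rewrite e vec_eq0 negbK => h; split=> //.
apply/esym/eqP; rewrite eqEdim dim_vline -e p0 p1 leqnn andbT -memvE.
exact: memv_pick.
Qed.

Lemma join_points x y z x' y' z' :
  nonzero3 (y * z' - z * y') (z * x' - x * z') (x * y' - y * x') ->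
  (<[vec x y z]> + <[vec x' y' z']>)%VS =
  bline (y * z' - z * y') (z * x' - x * z') (x * y' - y * x').
Proof.
move=> h; apply/vspaceP => w; have [u [v [t ->]]] := vecP w.
rewrite mem_bary_line; apply/memv_addP/eqP.
  move=> [_ /vlineP [k ->] [_ /vlineP [k' ->]]].
  by rewrite !vecZ vecD => /vec_inj [-> -> ->]; ring.
move/nonzero3P: h.
set a := y * z' - _; set b := z * x' - _; set c := x * y' - _.
set n := a ^+ 2 + _ + _ => n0 e.
(* Cramer's rule: for w = (u, v, t) and N = (a, b, c), n w is d times the first point plus d' times
   the second plus (w.N) N, and the last term vanishes on the line. *)
pose d := (v * z' - t * y') * a + (t * x' - u * z') * b
          + (u * y' - v * x') * c.
pose d' := (y * t - z * v) * a + (z * u - x * t) * b + (x * v - y * u) * c.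
exists ((d / n) *: vec x y z); first by rewrite memvZ ?memv_line.
exists ((d' / n) *: vec x' y' z'); first by rewrite memvZ ?memv_line.
have comb r s s' q : r * n - (d * s + d' * s') = q * (u * a + v * b + t * c) ->
    r = d / n * s + d' / n * s'.
  rewrite e mulr0 => /subr0_eq e'.
  by apply: (mulIf n0); rewrite e'; field.
rewrite !vecZ vecD; congr vec.
- by apply: (comb _ _ _ a); rewrite /n /d /d' /a /b /c; ring.
- by apply: (comb _ _ _ b); rewrite /n /d /d' /a /b /c; ring.
- by apply: (comb _ _ _ c); rewrite /n /d /d' /a /b /c; ring.
Qed.

Lemma meet_lines a b c a' b' c' :
  nonzero3 (b * c' - c * b') (c * a' - a * c') (a * b' - b * a') ->
  (bline a b c :&: bline a' b' c')%VS =
  <[vec (b * c' - c * b') (c * a' - a * c') (a * b' - b * a')]>%VS.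
Proof.
move=> h; apply/vspaceP => w; have [u [v [t ->]]] := vecP w.
rewrite memv_cap !mem_bary_line; apply/andP/vlineP; last first.
  by move=> [k]; rewrite vecZ => /vec_inj [-> -> ->]; split; apply/eqP; ring.
move=> [/eqP e /eqP e']; move/nonzero3P: h.
set x := b * c' - _; set y := c * a' - _; set z := a * b' - _.
set n := x ^+ 2 + _ + _ => n0.
(* This is the factor of the orthogonal projection of w = (u, v, t) on N = (x, y, z). By the double
   cross product formula, n w - d N is a combination of the two line equations, hence zero. *)
pose d := u * x + v * y + t * z; exists (d / n).
have comb r s q q' :
    r * n - d * s = q' * (u * a' + v * b' + t * c') - q * (u * a + v * b + t * c) ->
    r = d / n * s.
  rewrite e e' !mulr0 subrr => /subr0_eq e''.
  by apply: (mulIf n0); rewrite e''; field.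
rewrite vecZ; congr vec.
- apply: (comb _ _ (y * c' - z * b') (y * c - z * b)).
  by rewrite /d /n /x /y /z; ring.
- apply: (comb _ _ (z * a' - x * c') (z * a - x * c)).
  by rewrite /d /n /x /y /z; ring.
- apply: (comb _ _ (x * b' - y * a') (x * b - y * a)).
  by rewrite /d /n /x /y /z; ring.
Qed.

(** Rank-nullity: the linear form is onto, because its value at (a, b, c) is the nonzero sum of
    squares. *)
Lemma is_line_bary_line a b c : nonzero3 a b c -> is_line (bline a b c).
Proof.
move=> h; rewrite /is_line.
pose f : 'Hom('rV[R]_(2 + 1), 'rV[R]_1) :=
  linfun (mulmxr (invmx W *m (row3 a b c)^T)).
have := limg_ker_dim f fullv.
rewrite capfv (_ : \dim {:'rV[R]_(2 + 1)} = 3%N) ?dimvf ?dim_matrix //.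
rewrite -/(bary_line W a b c) (_ : \dim (limg f) = 1%N) ?addn1 => [[]//|].
apply/eqP; rewrite eqn_leq (leq_trans (dimvS (subvf _))) ?dimvf ?dim_matrix //=.
rewrite lt0n dimv_eq0; apply/negP => /eqP e.
have : vec a b c \in bline a b c.
  by rewrite memv_ker -memv0 -e memv_img ?memvf.
rewrite mem_bary_line => /eqP e'; move/nonzero3P: h => /eqP; apply.
by rewrite -e'; ring.
Qed.


End Frame.

(** * Conics and their centers *)

Section Conic.
Context (R : realType).
Implicit Types (S : 'M[R]_(2 + 1)) (X l m : subspace R).

(* At a singular point the two lines span the plane, and the form vanishes on
   each of them, so that their common point is in its kernel. *)
Lemma line_pair_center S l m :
  S^T = S -> is_line l -> is_line m -> l <> m ->
  conic_points S = line_pair l m ->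
  is_point (l :&: m)%VS /\ forall w, w \in (l :&: m)%VS -> w *m S = 0.
Proof.
move=> sS l2 m2 lm eS.
have dim3 : \dim {:'rV[R]_(2 + 1)} = 3%N by rewrite dimvf dim_matrix.
have dlm := dimv_sum_cap l m; rewrite l2 m2 in dlm.
have d3 : (\dim (l + m)%VS <= 3)%N by rewrite -dim3 dimvS ?subvf.
have capl : (\dim (l :&: m)%VS <= 2)%N
  by move: (dimvS (capvSl l m)); rewrite l2.
have cap2 : \dim (l :&: m)%VS <> 2%N.
  move=> d2; apply: lm; transitivity (l :&: m)%VS.
    by apply/esym/eqP; rewrite eqEdim capvSl d2 l2.
  by apply/eqP; rewrite eqEdim capvSr d2 m2.
(* Grassmann's formula: the sum has dimension at most 3, so the intersection has dimension at least
   2 + 2 - 3. *)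
have cap1 : \dim (l :&: m)%VS = 1%N.
  by lia.
split=> // w; rewrite memv_cap => /andP [wl wm].
have full : (l + m)%VS = fullv.
  by apply/eqP; rewrite eqEdim subvf dim3 /=; lia.
have iso n u : n = l \/ n = m -> u \in n -> u *m S *m u^T = 0.
  move=> hn un; have [->|u0] := eqVneq u 0; first by rewrite !mul0mx.
  have : conic_points S <[u]>%VS.
    rewrite eS; split; first by rewrite /is_point dim_vline u0.
    by case: hn => <-; rewrite -memvE; [left|right].
  by move=> [_]; apply; rewrite memv_line.
(* Polarization: the form vanishes at w, u and w + u, hence so does twice its bilinear value at w
   and u. *)
have orth n u : n = l \/ n = m -> w \in n -> u \in n -> w *m S *m u^T = 0.
  move=> hn wn un; have := iso _ _ hn (memvD wn un).
  rewrite linearD /= mulmxDl !mulmxDr !mulmxDl (iso _ _ hn wn) (iso _ _ hn un).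
  rewrite add0r addr0.
  have -> : u *m S *m w^T = w *m S *m u^T.
    transitivity (w *m S *m u^T)^T; first by rewrite !trmx_mul sS trmxK mulmxA.
    by apply/matrixP => i j; rewrite !ord1 mxE.
  by move=> /eqP; rewrite -mulr2n -scaler_nat scaler_eq0 Num.Theory.pnatr_eq0 => /eqP.
have all0 (u : 'rV[R]_(2 + 1)) : w *m S *m u^T = 0.
  have : u \in (l + m)%VS by rewrite full memvf.
  move=> /memv_addP [u1 u1l [u2 u2m ->]].
  by rewrite linearD mulmxDr (orth l u1) ?(orth m u2) ?addr0; auto.
apply/rowP => j; have /matrixP /(_ 0 0) := all0 (delta_mx 0 j).
by rewrite trmx_delta -colE !mxE.
Qed.

Context (W : 'M[R]_(2 + 1)) (W_unit : W \in unitmx).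
Local Notation vec := (bary W).
Local Notation bline := (bary_line W).

Section Form.
Context (S : 'M[R]_(2 + 1)) (g00 g11 g22 g12 g02 g01 : R).
Hypothesis S_sym3 : W *m S *m W^T = sym3 g00 g11 g22 g12 g02 g01.

Lemma conic_form x y z x' y' z' :
  vec x y z *m S *m (vec x' y' z')^T =
  ((x * g00 + y * g01 + z * g02) * x' + (x * g01 + y * g11 + z * g12) * y'
   + (x * g02 + y * g12 + z * g22) * z')%:M.
Proof.
by rewrite /bary trmx_mul -!mulmxA (mulmxA S) (mulmxA W) (mulmxA W) S_sym3
  mulmxA row3_sym3 row3_dot.
Qed.

Lemma conic_unitmx : (S \in unitmx) = (det3 g00 g11 g22 g12 g02 g01 != 0).
Proof.
rewrite -det_sym3 -S_sym3 -unitfE -unitmxE !unitmx_mul unitmx_tr W_unit.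
by rewrite andbT.
Qed.

Lemma conic_sym : S^T = S.
Proof.
have := tr_sym3 g00 g11 g22 g12 g02 g01; rewrite -S_sym3 !trmx_mul trmxK.
rewrite mulmxA => /(can_inj (mulmxK _)) /=; rewrite unitmx_tr => /(_ W_unit).
by move=> /(can_inj (mulKmx W_unit)).
Qed.

Lemma scalar11_eq0 (k : R) : (k%:M = 0 :> 'M_1) <-> k = 0.
Proof.
by split=> [/matrixP /(_ 0 0)|->]; rewrite ?raddf0 // !mxE mulr1n.
Qed.

Lemma mem_conic x y z : nonzero3 x y z ->
  conic_points S <[vec x y z]>%VS <->
  g00 * x ^+ 2 + g11 * y ^+ 2 + g22 * z ^+ 2
  + 2 * (g12 * y * z + g02 * x * z + g01 * x * y) = 0.
Proof.
move=> h; split=> [[_ /(_ (vec x y z))]|e].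
  rewrite memv_line conic_form scalar11_eq0 => /(_ isT) <-; ring.
split=> [|_ /vlineP [k ->]]; first exact: is_point_vline.
rewrite vecZ conic_form; apply/scalar11_eq0.
by rewrite -[RHS](mulr0 (k ^+ 2)) -e; ring.
Qed.

(** The polar of (x : y : z) has the line coordinates (k : k : k), which are those of the line at
    infinity as soon as k is nonzero. *)
Lemma pole_inf x y z (k : R) : nonzero3 x y z -> k != 0 ->
  x * g00 + y * g01 + z * g02 = k -> x * g01 + y * g11 + z * g12 = k ->
  x * g02 + y * g12 + z * g22 = k ->
  is_pole S (bline 1 1 1) <[vec x y z]>%VS.
Proof.
move=> h k0 e1 e2 e3; split=> [|v]; first exact: is_point_vline.
have [x' [y' [z' ->]]] := vecP W_unit v; rewrite mem_bary_line // !mulr1.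
split=> [/eqP e _ /vlineP [c ->]|/(_ (vec x y z) (memv_line _))].
  rewrite -!scalemxAl conic_form e1 e2 e3 -!mulrDr e mulr0.
  by rewrite raddf0 scaler0.
rewrite conic_form e1 e2 e3 scalar11_eq0 -!mulrDr => /eqP.
by rewrite mulf_eq0 (negPf k0).
Qed.

(** One linear condition covers both kinds of center: the polar of a pole of the line at infinity
    has equal coordinates, and the common point of a pair of lines lies in the kernel of [S], which
    gives k = 0. *)
Lemma center_inf X : line_inf R = bline 1 1 1 -> is_center S X ->
  exists x y z k, [/\ nonzero3 x y z, X = <[vec x y z]>%VS &
   [/\ x * g00 + y * g01 + z * g02 = k, x * g01 + y * g11 + z * g12 = k &
   x * g02 + y * g12 + z * g22 = k]].
Proof.
move=> inf [[_ [X1 pX]]|[_ [l [m [l2 m2 lm eS eX]]]]].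
  have [x [y [z [h e]]]] := is_pointP W_unit X1.
  exists x, y, z, (x * g00 + y * g01 + z * g02); split=> //; subst X.
  have pol x' y' z' : x' + y' + z' = 0 ->
    (x * g00 + y * g01 + z * g02) * x' + (x * g01 + y * g11 + z * g12) * y'
      + (x * g02 + y * g12 + z * g22) * z' = 0.
    move=> e; have [+ _] := pX (vec x' y' z').
    rewrite inf mem_bary_line // !mulr1 e eqxx => /(_ isT _ (memv_line _)).
    by rewrite conic_form scalar11_eq0.
  (* These two vectors span the plane x + y + z = 0 of the infinite points. *)
  have e1 := pol (-1) 1 0 ltac:(ring); have e2 := pol (-1) 0 1 ltac:(ring).
  by split=> //; lra.
have [X1 ker] := line_pair_center conic_sym l2 m2 lm eS.
rewrite -eX in X1 ker.
have [x [y [z [h e]]]] := is_pointP W_unit X1.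
exists x, y, z, 0; split=> //.
have k0 : vec x y z *m S = 0 by rewrite ker // e memv_line.
have pol x' y' z' :
    (x * g00 + y * g01 + z * g02) * x' + (x * g01 + y * g11 + z * g12) * y'
      + (x * g02 + y * g12 + z * g22) * z' = 0.
  by apply/scalar11_eq0; rewrite -conic_form k0 mul0mx.
split; first by rewrite -(pol 1 0 0); ring.
  by rewrite -(pol 0 1 0); ring.
by rewrite -(pol 0 0 1); ring.
Qed.

Lemma center_line_pair a b c a' b' c' :
  S \notin unitmx ->
  nonzero3 (b * c' - c * b') (c * a' - a * c') (a * b' - b * a') ->
  (forall x y z, g00 * x ^+ 2 + g11 * y ^+ 2 + g22 * z ^+ 2
    + 2 * (g12 * y * z + g02 * x * z + g01 * x * y) =
    2 * (x * a + y * b + z * c) * (x * a' + y * b' + z * c')) ->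
  is_center S
    <[vec (b * c' - c * b') (c * a' - a * c') (a * b' - b * a')]>%VS.
Proof.
move=> uS h fact; right; split=> //; exists (bline a b c), (bline a' b' c').
rewrite (meet_lines W_unit h).
have h1 : nonzero3 a b c.
  apply: contraTT h; rewrite /nonzero3 !negb_or !negbK.
  by move=> /and3P [/eqP-> /eqP-> /eqP->]; rewrite !mul0r !subrr eqxx.
have h2 : nonzero3 a' b' c'.
  apply: contraTT h; rewrite /nonzero3 !negb_or !negbK.
  by move=> /and3P [/eqP-> /eqP-> /eqP->]; rewrite !mulr0 !subrr eqxx.
split=> //; try exact: is_line_bary_line.
  (* If the lines coincided, their intersection would have dimension 2, yet it is spanned by one
     vector. *)
  move=> e; have := meet_lines W_unit h; rewrite -e capvv => e1.
  have := is_line_bary_line W_unit h1.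
  by rewrite /is_line e1 dim_vline; case: (_ != 0).
apply/seteqP; split=> [X [X1 hX]|X [X1 hX]];
  have [x [y [z [hx e]]]] := is_pointP W_unit X1; subst X.
  split=> //; have [/(_ (conj X1 hX)) + _] := mem_conic hx.
  rewrite fact -!memvE !mem_bary_line // => /eqP.
  rewrite !mulf_eq0 Num.Theory.pnatr_eq0 /= => /orP [h0|h0]; [left|right]; exact: h0.
apply/mem_conic => //; rewrite fact.
move: hX; rewrite -!memvE !mem_bary_line // => [[/eqP->|/eqP->]]; ring.
Qed.

End Form.

Definition frame_form (G : 'M[R]_(2 + 1)) : 'M[R]_(2 + 1) :=
  invmx W *m G *m (invmx W)^T.

Lemma frame_formK G : W *m frame_form G *m W^T = G.
Proof.
rewrite /frame_form -!mulmxA -trmx_mul mulmxV // trmx1 mulmx1 mulKVmx //.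
Qed.

End Conic.

(** * Affine maps in the frame of a triangle *)

Definition aff_mx (R : realType) (f : affmap R) : 'M[R]_(2 + 1) :=
  block_mx (lin f) 0 (trans f) 1%:M.

Definition triangle_frame (R : realType) (A B C : 'rV[R]_2) : 'M[R]_(2 + 1) :=
  \matrix_i row_mx (nth 0 [:: A; B; C] i) 1%:M.

Section Affine.
Context (R : realType).
Implicit Types (f g : affmap R) (u : 'rV[R]_(2 + 1)) (p : subspace R).

Lemma act_vline f u : act f <[u]>%VS = <[u *m aff_mx f]>%VS.
Proof. by rewrite /act limg_line lfunE. Qed.

Lemma aff_mx_comp f g : aff_mx (aff_comp f g) = aff_mx g *m aff_mx f.
Proof.
by rewrite /aff_mx mulmx_block !mulmx0 !mul0mx mul1mx mulmx1 !addr0 !add0r.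
Qed.

Lemma row_mx_aff (X : 'rV[R]_2) (t : 'M_1) f :
  row_mx X t *m aff_mx f = row_mx (X *m lin f + t *m trans f) t.
Proof. by rewrite /aff_mx mul_row_block mulmx0 mulmx1 add0r. Qed.

Lemma rsubmx_aff u f : rsubmx (u *m aff_mx f) = rsubmx u.
Proof. by rewrite -[u]hsubmxK row_mx_aff !row_mxKr. Qed.

Lemma act_comp f g p : act (aff_comp f g) p = act f (act g p).
Proof.
rewrite /act -!/(aff_mx _) aff_mx_comp -limg_comp; congr (_ @: _)%VS.
by apply/lfunP => u; rewrite comp_lfunE !lfunE /= mulmxA.
Qed.

Lemma aff_inv_homothety (c : 'rV[R]_2) (k : R) : k != 0 ->
  aff_inv (homothety c k) = homothety c k^-1.
Proof.
move=> k0; rewrite /aff_inv /homothety /= invmx_scalar; congr Affmap.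
rewrite mul_mx_scalar scalerA -scaleNr; congr (_ *: _).
by field.
Qed.

End Affine.

Section Triangle.
Context (R : realType) (A B C : 'rV[R]_2).
Hypothesis ABC : triangle A B C.
Local Notation W := (triangle_frame A B C).
Local Notation vec := (bary W).
Local Notation bline := (bary_line W).

Lemma vec_row_mx x y z :
  vec x y z = row_mx (x *: A + y *: B + z *: C) (x + y + z)%:M.
Proof.
rewrite /bary row3_mul !rowK /= inordK //= !scale_row_mx !add_row_mx.
by rewrite !scale_scalar_mx !mulr1 -!raddfD.
Qed.

(** In a vanishing combination of the rows the last entry makes the coefficients add up to 0.
    Eliminating the first one leaves a relation between [B - A] and [C - A]. *)
Lemma triangle_frame_unit : W \in unitmx.
Proof.
rewrite -row_free_unit; apply: inj_row_free => u; have [x [y [z ->]]] := row3P u.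
rewrite -/(bary _ x y z) vec_row_mx -[0]hsubmxK => /eq_row_mx [].
rewrite !linear0 => e /matrixP /(_ 0 0); rewrite !mxE mulr1n => s.
have ex : x = - y - z by lra.
move: ABC; rewrite /triangle => /(@freeP _ _ 2 [tuple B - A; C - A]).
move=> /(_ (fun i => if i == 0 then y else z)); rewrite !big_ord_recl big_ord0 /=.
have -> : y *: (B - A) + (z *: (C - A) + 0) = 0.
  by rewrite addr0 -[RHS]e ex; apply/rowP => j; rewrite !mxE; ring.
move=> /(_ erefl) h.
have y0 := h 0; have z0 := h 1; rewrite /= in y0 z0.
by rewrite ex y0 z0 !oppr0 addr0 row3_0 row_mx0.
Qed.

Let W_unit := triangle_frame_unit.

Lemma pt_A : pt A = <[vec 1 0 0]>%VS.
Proof. by rewrite vec_row_mx scale1r !scale0r !addr0. Qed.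

Lemma pt_B : pt B = <[vec 0 1 0]>%VS.
Proof. by rewrite vec_row_mx scale1r !scale0r !addr0 !add0r. Qed.

Lemma pt_C : pt C = <[vec 0 0 1]>%VS.
Proof. by rewrite vec_row_mx scale1r !scale0r !add0r. Qed.

Lemma line_BC : line_through B C = bline 1 0 0.
Proof.
rewrite /line_through pt_B pt_C join_points // /nonzero3; last first.
  by rewrite mulr1 mul0r subr0 oner_eq0.
by apply: bary_line_eq; ring.
Qed.

Lemma line_CA : line_through C A = bline 0 1 0.
Proof.
rewrite /line_through pt_C pt_A join_points // /nonzero3; last first.
  by rewrite mulr1 mul0r subr0 oner_eq0 orbT.
by apply: bary_line_eq; ring.
Qed.

Lemma line_AB : line_through A B = bline 0 0 1.
Proof.
rewrite /line_through pt_A pt_B join_points // /nonzero3; last first.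
  by rewrite !mulr1 !mul0r !subr0 oner_eq0 !orbT.
by apply: bary_line_eq; ring.
Qed.

Lemma line_inf_bary : line_inf R = bline 1 1 1.
Proof.
apply/vspaceP => w; have [x [y [z ->]]] := vecP W_unit w.
rewrite [RHS]mem_bary_line // memv_ker lfunE /= vec_row_mx row_mxKr !mulr1.
apply/eqP/eqP => [|->]; last by rewrite raddf0.
by move=> /matrixP /(_ 0 0); rewrite !mxE mulr1n.
Qed.

Lemma vec_aff f a1 a2 a3 b1 b2 b3 c1 c2 c3 x y z :
  vec 1 0 0 *m aff_mx f = vec a1 a2 a3 ->
  vec 0 1 0 *m aff_mx f = vec b1 b2 b3 ->
  vec 0 0 1 *m aff_mx f = vec c1 c2 c3 ->
  vec x y z *m aff_mx f =
  vec (x * a1 + y * b1 + z * c1) (x * a2 + y * b2 + z * c2)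
    (x * a3 + y * b3 + z * c3).
Proof.
by move=> ea eb ec; rewrite vec_rows !mulmxDl -!scalemxAl ea eb ec !vecZ !vecD.
Qed.

(* The third homogeneous coordinate of a vector is the sum of its barycentric
   coordinates, and an affine map preserves it. *)
Lemma act_normalized f x y z x' y' z' :
  x + y + z = 1 -> act f <[vec x y z]>%VS = <[vec x' y' z']>%VS ->
  vec x y z *m aff_mx f =
  vec (x' / (x' + y' + z')) (y' / (x' + y' + z')) (z' / (x' + y' + z')).
Proof.
move=> s1; rewrite act_vline => e.
have [k ek] : exists k, vec x y z *m aff_mx f = k *: vec x' y' z'.
  by apply/vlineP; rewrite -e memv_line.
have k1 : k * (x' + y' + z') = 1.
  have := rsubmx_aff (vec x y z) f.
  rewrite ek vecZ !vec_row_mx !row_mxKr s1 => /matrixP /(_ 0 0).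
  by rewrite !mxE !mulr1n -!mulrDr.
have n0 : x' + y' + z' != 0.
  by apply/eqP => n0; move/eqP: k1; rewrite n0 mulr0 eq_sym oner_eq0.
rewrite ek vecZ; congr vec; apply: (mulIf n0); rewrite divfK //;
  by rewrite -[RHS]mulr1 -k1; ring.
Qed.

Lemma vec_homothety_mid_BC x y z :
  vec x y z *m aff_mx (homothety (midpoint B C) (-1)) =
  vec (- x) (x + z) (x + y).
Proof.
rewrite !vec_row_mx row_mx_aff /= mul_mx_scalar; congr row_mx; last first.
  by congr _%:M; ring.
by rewrite mul_scalar_mx; apply/rowP => j; rewrite !mxE; field.
Qed.

Lemma vec_homothety_mid_CA x y z :
  vec x y z *m aff_mx (homothety (midpoint C A) (-1)) =
  vec (y + z) (- y) (y + x).
Proof.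
rewrite !vec_row_mx row_mx_aff /= mul_mx_scalar; congr row_mx; last first.
  by congr _%:M; ring.
by rewrite mul_scalar_mx; apply/rowP => j; rewrite !mxE; field.
Qed.

Lemma vec_homothety_mid_AB x y z :
  vec x y z *m aff_mx (homothety (midpoint A B) (-1)) =
  vec (z + y) (z + x) (- z).
Proof.
rewrite !vec_row_mx row_mx_aff /= mul_mx_scalar; congr row_mx; last first.
  by congr _%:M; ring.
by rewrite mul_scalar_mx; apply/rowP => j; rewrite !mxE; field.
Qed.

Lemma vec_complement x y z :
  vec x y z *m aff_mx (complement A B C) =
  vec ((y + z) / 2) ((z + x) / 2) ((x + y) / 2).
Proof.
rewrite !vec_row_mx row_mx_aff /= mul_mx_scalar; congr row_mx; last first.
  by congr _%:M; field.
by rewrite mul_scalar_mx; apply/rowP => j; rewrite !mxE; field.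
Qed.

Lemma vec_inv_complement x y z :
  vec x y z *m aff_mx (aff_inv (complement A B C)) =
  vec (y + z - x) (z + x - y) (x + y - z).
Proof.
have two0 : - 2^-1 != 0 :> R by apply/eqP; lra.
rewrite aff_inv_homothety // !vec_row_mx row_mx_aff /= mul_mx_scalar.
congr row_mx; last by congr _%:M; ring.
by rewrite mul_scalar_mx; apply/rowP => j; rewrite !mxE; field.
Qed.

End Triangle.

(** * The configuration of the point (p : q : r) *)

(** It allows invertibility to be shown by exhibiting preimages instead of expanding a
    determinant. *)
Lemma surj_unitmx (R : realType) n (F : 'M[R]_n) :
  (forall u : 'rV_n, exists v, u = v *m F) -> F \in unitmx.
Proof.
move=> h; rewrite -row_full_unit -sub1mx; apply/row_subP => i.
by have [v ->] := h (row i 1%:M); apply: submxMl.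
Qed.

(* A binary quadratic form with a single zero is a multiple of a square: the
   second zero on the line through (s : t) and (1 : 0) coincides with the first. *)
Lemma double_root (R : realType) (g h f s t : R) : s != 0 -> t != 0 ->
  g * s ^+ 2 + f * t ^+ 2 + 2 * (h * s * t) = 0 ->
  (forall y z, (y != 0) || (z != 0) ->
     g * y ^+ 2 + f * z ^+ 2 + 2 * (h * y * z) = 0 -> s * z = t * y) ->
  [/\ g != 0, h = - g * s / t & f = g * (s / t) ^+ 2].
Proof.
move=> s0 t0 e uniq.
have g0 : g != 0.
  (* With g = 0 the point (1 : 0) would be a zero, distinct from (s : t) because t is nonzero. *)
  apply/eqP => g0; have := uniq 1 0; rewrite oner_eq0 g0 => /(_ isT ltac:(ring)).
  by rewrite mulr0 mulr1 => /esym /eqP; rewrite (negPf t0).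
have eh : g * s + h * t = 0.
  (* By Vieta, the roots y at z = t add up to -2 h t / g, so this is the root other than s. *)
  have := uniq (s - 2 * (g * s + h * t) / g) t; rewrite t0 orbT => /(_ isT).
  have -> : g * (s - 2 * (g * s + h * t) / g) ^+ 2 + f * t ^+ 2
    + 2 * (h * (s - 2 * (g * s + h * t) / g) * t) =
    g * s ^+ 2 + f * t ^+ 2 + 2 * (h * s * t) by field.
  move=> /(_ e) e'; have two0 : 2 * t / g != 0.
    by rewrite !mulf_neq0 ?invr_eq0 // Num.Theory.pnatr_eq0.
  by apply: (mulfI two0); rewrite mulr0; lra.
have eh' : h = - g * s / t.
  by apply: (mulIf t0); rewrite divfK //; lra.
split=> //; apply: (mulIf (mulf_neq0 t0 t0)).
rewrite (_ : g * (s / t) ^+ 2 * (t * t) = g * s ^+ 2); last by field.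
apply: subr0_eq; transitivity
  (g * s ^+ 2 + f * t ^+ 2 + 2 * (h * s * t) - 2 * s * (g * s + h * t)); first ring.
by rewrite e eh; ring.
Qed.

Section Configuration.
Context (R : realType) (A B C : 'rV[R]_2).
Hypothesis ABC : triangle A B C.
Local Notation W := (triangle_frame A B C).
Local Notation vec := (bary W).
Local Notation bline := (bary_line W).
Let W_unit := triangle_frame_unit ABC.
Context (p q r : R).
Local Notation P := (<[vec p q r]>%VS).

(** * Coordinates of [P], of its traces and of its isotomic conjugate *)

Lemma off_sides_coords :
  off_sides A B C P -> [/\ p != 0, q != 0 & r != 0].
Proof.
case; rewrite (line_BC ABC) (line_CA ABC) (line_AB ABC) -!memvE !mem_bary_line //.
by rewrite !mulr0 !mulr1 !addr0 !add0r.
Qed.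

Lemma act_pt f (X : 'rV[R]_2) : pt (aff_fun f X) = act f (pt X).
Proof. by rewrite act_vline row_mx_aff mul1mx. Qed.

(** The side of the anticomplementary triangle through [A] is the parallel y + z = 0 to BC, and
    cyclically. *)
Lemma off_anticomplementary_coords :
  off_anticomplementary_sides A B C P ->
  [/\ q + r != 0, p + r != 0 & p + q != 0].
Proof.
rewrite /off_anticomplementary_sides /off_sides /line_through !act_pt.
rewrite (pt_A A B C) (pt_B A B C) (pt_C A B C) !act_vline !vec_inv_complement.
rewrite !join_points //; try by apply/nonzero3P; apply/eqP => ?; lra.
rewrite -!memvE !mem_bary_line // => -[h1 h2 h3]; split.
- by apply: contra_neq h1 => e; lra.
- by apply: contra_neq h2 => e; lra.
- by apply: contra_neq h3 => e; lra.
Qed.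

Hypotheses (p0 : p != 0) (q0 : q != 0) (r0 : r != 0).
(** These are the coordinate sums of the traces: the traces are ordinary points and can be
    normalized. *)
Hypotheses (qr0 : q + r != 0) (pr0 : p + r != 0) (pq0 : p + q != 0).

Lemma trace_A : trace A B C P = <[vec 0 q r]>%VS.
Proof.
rewrite /trace (pt_A A B C) (line_BC ABC) join_points ?meet_lines //.
- by apply: vline_bary_eq; ring.
- by rewrite /nonzero3 !(mulr0, mul0r, mulr1, mul1r, subr0, sub0r, opprK)
    q0 orbT.
- by rewrite /nonzero3 !(mulr0, mul0r, mulr1, mul1r, subr0, sub0r, opprK)
    q0 !orbT.
Qed.

Lemma trace_B : trace B C A P = <[vec p 0 r]>%VS.
Proof.
rewrite /trace (pt_B A B C) (line_CA ABC) join_points ?meet_lines //.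
- by apply: vline_bary_eq; ring.
- by rewrite /nonzero3 !(mulr0, mul0r, mulr1, mul1r, subr0, sub0r, opprK)
    p0.
- by rewrite /nonzero3 !(mulr0, mul0r, mulr1, mul1r, subr0, sub0r, opprK)
    r0.
Qed.

Lemma trace_C : trace C A B P = <[vec p q 0]>%VS.
Proof.
rewrite /trace (pt_C A B C) (line_AB ABC) join_points ?meet_lines //.
- by apply: vline_bary_eq; ring.
- by rewrite /nonzero3 !(mulr0, mul0r, mulr1, mul1r, subr0, sub0r, opprK)
    p0.
- by rewrite /nonzero3 !(mulr0, mul0r, mulr1, mul1r, subr0, sub0r, opprK)
    p0 orbT.
Qed.

Lemma refl_trace_A : refl_trace A B C P = <[vec 0 r q]>%VS.
Proof.
rewrite /refl_trace trace_A act_vline vec_homothety_mid_BC.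
by apply: vline_bary_eq; ring.
Qed.

Lemma refl_trace_B : refl_trace B C A P = <[vec r 0 p]>%VS.
Proof.
rewrite /refl_trace trace_B act_vline vec_homothety_mid_CA.
by apply: vline_bary_eq; ring.
Qed.

Lemma refl_trace_C : refl_trace C A B P = <[vec q p 0]>%VS.
Proof.
rewrite /refl_trace trace_C act_vline vec_homothety_mid_AB.
by apply: vline_bary_eq; ring.
Qed.

Lemma isotomic_bary :
  isotomic A B C P = <[vec (q * r) (p * r) (p * q)]>%VS.
Proof.
rewrite /isotomic refl_trace_A refl_trace_B refl_trace_C.
rewrite (pt_A A B C) (pt_B A B C) (pt_C A B C).
rewrite !join_points //;
  try by rewrite /nonzero3 !(mulr0, mul0r, mulr1, mul1r, subr0, sub0r)
    ?p0 ?q0 ?r0 ?orbT.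
rewrite meet_lines //; last first.
  by apply/orP; left; apply: contra_neq (mulf_neq0 q0 r0) => e; lra.
rewrite (_ : <[_]>%VS =
    <[vec (q * r) (p * r) (p * q)]>%VS); last first.
  by apply: vline_bary_eq; ring.
(* Concurrence: the common point of the first two lines lies on the third. *)
by apply/capv_idPl; rewrite -memvE mem_bary_line //; apply/eqP; ring.
Qed.

Lemma complement_isotomic :
  act (complement A B C) (isotomic A B C P) =
  <[vec (p * (q + r)) (q * (p + r)) (r * (p + q))]>%VS.
Proof.
rewrite isotomic_bary act_vline vec_complement.
have h := mulf_neq0 p0 qr0.
have two0 : 2 != 0 :> R by apply/eqP; lra.
apply: vline_eq => //; rewrite /nonzero3 ?h //; try by field.
rewrite (_ : p * r + p * q = p * (q + r)); last by ring.
by rewrite mulf_neq0 // invr_neq0.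
Qed.

(** * The nine-point conic of the quadrangle [A], [B], [C], P' *)

(* Twice the form, so that its matrix has no halves. *)
Definition nine_point_mx : 'M[R]_(2 + 1) :=
  frame_form W (sym3 (- (2 * p)) (- (2 * q)) (- (2 * r)) (q + r) (p + r) (p + q)).

Lemma mem_nine_point_mx x y z : nonzero3 x y z ->
  conic_points nine_point_mx <[vec x y z]>%VS <->
  p * (x * (y + z - x)) + q * (y * (z + x - y)) + r * (z * (x + y - z)) = 0.
Proof.
move=> h; rewrite (mem_conic W_unit (frame_formK W_unit _) h); lra.
Qed.

(** Eliminating k makes (a, b, c) proportional to (x (y + z - x), y (z + x - y), z (x + y - z));
    substituting this in ap + bq + cr = 0 gives the equation. *)
Lemma pole_on_nine_point x y z k a b c :
  nonzero3 a b c -> a * p + b * q + c * r = 0 ->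
  y * c + z * b = k -> x * c + z * a = k -> x * b + y * a = k ->
  p * (x * (y + z - x)) + q * (y * (z + x - y)) + r * (z * (x + y - z)) = 0.
Proof.
move=> abc e /eqP; rewrite -subr_eq0 => /eqP u1 /eqP; rewrite -subr_eq0 => /eqP u2.
move=> /eqP; rewrite -subr_eq0 => /eqP u3; set N := LHS.
have e12 : a * (y * (z + x - y)) = b * (x * (y + z - x)).
  apply: subr0_eq; transitivity ((x - y) * (x * b + y * a - k)
    + y * (x * c + z * a - k) - x * (y * c + z * b - k)); first ring.
  by rewrite u1 u2 u3; ring.
have e13 : a * (z * (x + y - z)) = c * (x * (y + z - x)).
  apply: subr0_eq; transitivity ((x - z) * (x * c + z * a - k)
    + z * (x * b + y * a - k) - x * (y * c + z * b - k)); first ring.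
  by rewrite u1 u2 u3; ring.
have e23 : b * (z * (x + y - z)) = c * (y * (z + x - y)).
  apply: subr0_eq; transitivity ((y - z) * (y * c + z * b - k)
    + z * (x * b + y * a - k) - y * (x * c + z * a - k)); first ring.
  by rewrite u1 u2 u3; ring.
(* Which of a, b, c is nonzero is unknown, so each of them is multiplied with [N]. *)
have [aN bN cN] : [/\ a * N = 0, b * N = 0 & c * N = 0].
  split.
  - transitivity (x * (y + z - x) * (a * p + b * q + c * r)); last by rewrite e mulr0.
    transitivity (p * (a * (x * (y + z - x))) + q * (a * (y * (z + x - y)))
                  + r * (a * (z * (x + y - z)))); first by rewrite /N; ring.
    by rewrite e12 e13; ring.
  - transitivity (y * (z + x - y) * (a * p + b * q + c * r)); last by rewrite e mulr0.
    transitivity (p * (b * (x * (y + z - x))) + q * (b * (y * (z + x - y)))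
                  + r * (b * (z * (x + y - z)))); first by rewrite /N; ring.
    by rewrite e23 -e12; ring.
  - transitivity (z * (x + y - z) * (a * p + b * q + c * r)); last by rewrite e mulr0.
    transitivity (p * (c * (x * (y + z - x))) + q * (c * (y * (z + x - y)))
                  + r * (c * (z * (x + y - z)))); first by rewrite /N; ring.
    by rewrite -e23 -e13; ring.
by case/or3P: abc => t0; apply: (mulfI t0); rewrite mulr0.
Qed.

(* The pencil of conics through A, B, C, P' is the set of the conics
   a yz + b zx + c xy = 0 with ap + bq + cr = 0.  The first choice of (a, b, c)
   inverts the map sending a conic to its center; it is undefined at the
   midpoints of the sides. *)
Lemma nine_point_pole x y z :
  nonzero3 x y z ->
  p * (x * (y + z - x)) + q * (y * (z + x - y)) + r * (z * (x + y - z)) = 0 ->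
  exists a b c k, [/\ nonzero3 a b c, a * p + b * q + c * r = 0,
    y * c + z * b = k, x * c + z * a = k & x * b + y * a = k].
Proof.
move=> h e.
have [n|] := boolP (nonzero3 (x * (y + z - x)) (y * (z + x - y)) (z * (x + y - z))).
  do 4!eexists; split; first exact: n.
  - by rewrite -e; ring.
  - reflexivity.
  - by ring.
  - by ring.
rewrite !negb_or !negbK !mulf_eq0 => /and3P.
move=> [/orP [] /eqP e1 /orP [] /eqP e2 /orP [] /eqP e3].
(* Of the eight choices of vanishing factors, five force x = y = z = 0; the other three give the
   midpoints of the sides. *)
all: try by exfalso; move/nonzero3P: h => /eqP []; have [-> -> ->] :
  [/\ x = 0, y = 0 & z = 0]; [split; lra | ring].
(* At the midpoint of BC the pole equations reduce to a = b + c with k = z a; the witness solves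
   this together with ap + bq + cr = 0. *)
- have -> : y = z by lra.
  exists (r - q), (p + r), (- (p + q)), (z * (r - q)); split; rewrite ?e1; try ring.
  by rewrite /nonzero3 pr0 orbT.
- have -> : x = z by lra.
  exists (q + r), (r - p), (- (p + q)), (z * (r - p)); split; rewrite ?e2; try ring.
  by rewrite /nonzero3 qr0.
- have -> : x = y by lra.
  exists (q + r), (- (p + r)), (q - p), (y * (q - p)); split; rewrite ?e3; try ring.
  by rewrite /nonzero3 qr0.
Qed.

(** Passing through [A], [B], [C] kills the diagonal of the matrix, and passing through P' gives ap
    + bq + cr = 0 up to the factor 2pqr. The center condition then allows the elimination of a, b,
    c. *)
Lemma nine_point_conic_sub X :
  nine_point_conic A B C (isotomic A B C P) X -> conic_points nine_point_mx X.
Proof.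
move=> [S [[S0 sS] [SA SB SC SP'] cS]].
have [g00 [g11 [g22 [a [b [c eS]]]]]] : exists g00 g11 g22 g12 g02 g01,
    W *m S *m W^T = sym3 g00 g11 g22 g12 g02 g01.
  by apply: sym3P; rewrite !trmx_mul trmxK sS mulmxA.
move: SA SB SC SP'; rewrite isotomic_bary // (pt_A A B C) (pt_B A B C) (pt_C A B C).
have n1 : nonzero3 (1 : R) 0 0 by rewrite /nonzero3 oner_eq0.
have n2 : nonzero3 (0 : R) 1 0 by rewrite /nonzero3 oner_eq0 orbT.
have n3 : nonzero3 (0 : R) 0 1 by rewrite /nonzero3 oner_eq0 !orbT.
have n4 : nonzero3 (q * r) (p * r) (p * q) by rewrite /nonzero3 mulf_neq0.
do 4![rewrite (mem_conic W_unit eS) //].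
move=> eA eB eC eP; have [a0 b0 c0] : [/\ g00 = 0, g11 = 0 & g22 = 0] by split; lra.
subst g00 g11 g22.
have [x [y [z [k [h -> [e1 e2 e3]]]]]] := center_inf W_unit eS (line_inf_bary ABC) cS.
apply/mem_nine_point_mx => //; apply: (@pole_on_nine_point x y z k a b c).
- apply: contraNT S0; rewrite !negb_or !negbK => /and3P [/eqP a0 /eqP b0 /eqP c0].
  have : W *m S *m W^T = 0.
    rewrite eS a0 b0 c0; apply/matrixP => i j; rewrite !mxE.
    by case: i j => [[|[|[|//]]] ?] [[|[|[|//]]] ?].
  move=> /(congr1 (mulmx (invmx W))); rewrite -!mulmxA mulKmx // mulmx0.
  move=> /(congr1 (mulmx^~ (invmx W^T))); rewrite mulmxK ?unitmx_tr // mul0mx.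
  by move=> ->.
- have pqr0 : 2 * (p * q * r) != 0 by rewrite !mulf_neq0 // Num.Theory.pnatr_eq0.
  by apply: (mulfI pqr0); rewrite mulr0 -eP; ring.
- by rewrite -e1; ring.
- by rewrite -e2; ring.
- by rewrite -e3; ring.
Qed.

(** The conic supplied by [nine_point_pole] has determinant 2abc. If this is nonzero, X is the pole
    of the line at infinity; otherwise the conic is a pair of opposite sides of the quadrangle,
    meeting at X. *)
Lemma sub_nine_point_conic X :
  conic_points nine_point_mx X -> nine_point_conic A B C (isotomic A B C P) X.
Proof.
move=> XN; have [X1 _] := XN; have [x [y [z [h eX]]]] := is_pointP W_unit X1.
move: XN; rewrite eX mem_nine_point_mx // => /(nine_point_pole h).
move=> [a [b [c [k [abc e e1 e2 e3]]]]].
pose S := frame_form W (sym3 0 0 0 a b c).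
have eS : W *m S *m W^T = sym3 0 0 0 a b c by exact: frame_formK.
exists S; rewrite isotomic_bary // (pt_A A B C) (pt_B A B C) (pt_C A B C).
have n1 : nonzero3 (1 : R) 0 0 by rewrite /nonzero3 oner_eq0.
have n2 : nonzero3 (0 : R) 1 0 by rewrite /nonzero3 oner_eq0 orbT.
have n3 : nonzero3 (0 : R) 0 1 by rewrite /nonzero3 oner_eq0 !orbT.
have n4 : nonzero3 (q * r) (p * r) (p * q) by rewrite /nonzero3 mulf_neq0.
split.
- split; last exact: conic_sym W_unit _ _ _ _ _ _ _ eS.
  apply: contraTneq abc => S0; move: eS; rewrite S0 mulmx0 mul0mx.
  by move=> /esym /sym3_inj0 [_ [-> -> ->]]; rewrite /nonzero3 eqxx.
- split; apply/(mem_conic W_unit eS) => //; try ring.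
  transitivity (2 * (p * q * r) * (a * p + b * q + c * r)); first ring.
  by rewrite e mulr0.
have detS : (S \in unitmx) = (a * b * c != 0).
  rewrite (conic_unitmx W_unit eS).
  rewrite (_ : det3 _ _ _ _ _ _ = 2 * (a * b * c)); last by rewrite /det3; ring.
  by rewrite mulf_eq0 Num.Theory.pnatr_eq0.
have [abc0|abc0] := boolP (a * b * c == 0); last first.
  left; rewrite detS abc0 (line_inf_bary ABC); split=> //.
  apply: (pole_inf W_unit eS h (k := k)); [|lra..].
  (* For k = 0 the pole equations form a homogeneous system of determinant 2abc, with no solution
     but zero. *)
  apply/negP => /eqP k0; subst k; rewrite k0 in e2 e3.
  have [a0 b0 c0] : [/\ a != 0, b != 0 & c != 0].
    by move: abc0; rewrite !mulf_eq0 !negb_or -!andbA => /and3P.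
  have two0 : 2 != 0 :> R by rewrite Num.Theory.pnatr_eq0.
  have [ex ey ez] : [/\ x = 0, y = 0 & z = 0].
    split.
    - apply: (mulfI (mulf_neq0 (mulf_neq0 two0 b0) c0)); rewrite mulr0.
      transitivity (c * (x * b + y * a) + b * (x * c + z * a) - a * (y * c + z * b)).
        by ring.
      by rewrite e2 e3 k0; ring.
    - apply: (mulfI (mulf_neq0 (mulf_neq0 two0 a0) c0)); rewrite mulr0.
      transitivity (c * (x * b + y * a) - b * (x * c + z * a) + a * (y * c + z * b)).
        by ring.
      by rewrite e2 e3 k0; ring.
    - apply: (mulfI (mulf_neq0 (mulf_neq0 two0 a0) b0)); rewrite mulr0.
      transitivity (- c * (x * b + y * a) + b * (x * c + z * a) + a * (y * c + z * b)).
        by ring.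
      by rewrite e2 e3 k0; ring.
  by move: h; rewrite ex ey ez /nonzero3 eqxx.
have uS : S \notin unitmx by rewrite detS negbK.
have nz0 (s t : R) : s != 0 -> t * s = 0 -> t = 0.
  by move=> s0 /eqP; rewrite mulf_eq0 (negPf s0) orbF => /eqP.
move: abc0; rewrite !mulf_eq0 -!orbA => /or3P [] /eqP t0; [subst a|subst b|subst c].
(* Here the conic is x (c y + b z) = 0, the pair of BC and AP', and X is the trace of P' on BC.
   Since bq + cr = 0, neither b nor c vanishes; x = 0, as otherwise b = c, against q + r being
   nonzero. *)
- have b0 : b != 0.
    apply: contraTneq abc => b0; rewrite /nonzero3 b0 eqxx /=.
    by rewrite (nz0 _ c r0) ?eqxx // -e b0; ring.
  have c0 : c != 0.
    apply: contraTneq abc => c0; rewrite /nonzero3 c0 eqxx /=.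
    by rewrite (nz0 _ b q0) ?eqxx // -e c0; ring.
  have x0 : x = 0.
    have [//|x0] := eqVneq x 0; have bc : b = c by apply: (mulfI x0); lra.
    by case/eqP: b0; apply: (nz0 _ _ qr0); rewrite -e bc; ring.
  (* The cross product of the line coordinates (1, 0, 0) and (0, c, b) is left unreduced to match
     [center_line_pair]. *)
  rewrite (_ : <[_]>%VS =
    <[vec (0 * b - 0 * c) (0 * 0 - 1 * b) (1 * c - 0 * 0)]>%VS).
    apply: (center_line_pair W_unit eS uS); last by move=> *; ring.
    by rewrite /nonzero3 !(mul0r, mulr0, mul1r, subr0) c0 !orbT.
  apply: vline_eq => //; try (rewrite ?x0; ring).
    by rewrite /nonzero3 !(mul0r, mulr0, mul1r, subr0) c0 !orbT.
  by rewrite x0 in e1 e2; lra.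
- have a0 : a != 0.
    apply: contraTneq abc => a0; rewrite /nonzero3 a0 eqxx /=.
    by rewrite (nz0 _ c r0) ?eqxx // -e a0; ring.
  have c0 : c != 0.
    apply: contraTneq abc => c0; rewrite /nonzero3 c0 eqxx /=.
    by rewrite (nz0 _ a p0) ?eqxx // -e c0; ring.
  have y0 : y = 0.
    have [//|y0] := eqVneq y 0; have ac : a = c by apply: (mulfI y0); lra.
    by case/eqP: a0; apply: (nz0 _ _ pr0); rewrite -e ac; ring.
  rewrite (_ : <[_]>%VS =
    <[vec (1 * a - 0 * 0) (0 * c - 0 * a) (0 * 0 - 1 * c)]>%VS).
    apply: (center_line_pair W_unit eS uS); last by move=> *; ring.
    by rewrite /nonzero3 !(mul0r, mulr0, mul1r, subr0) a0.
  apply: vline_eq => //; try (rewrite ?y0; ring).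
    by rewrite /nonzero3 !(mul0r, mulr0, mul1r, subr0) a0.
  by rewrite y0 in e1 e2; lra.
- have a0 : a != 0.
    apply: contraTneq abc => a0; rewrite /nonzero3 a0 eqxx /=.
    by rewrite (nz0 _ b q0) ?eqxx // -e a0; ring.
  have b0 : b != 0.
    apply: contraTneq abc => b0; rewrite /nonzero3 b0 eqxx /=.
    by rewrite (nz0 _ a p0) ?eqxx // -e b0; ring.
  have z0 : z = 0.
    have [//|z0] := eqVneq z 0; have ab : a = b by apply: (mulfI z0); lra.
    by case/eqP: a0; apply: (nz0 _ _ pq0); rewrite -e ab; ring.
  rewrite (_ : <[_]>%VS =
    <[vec (0 * 0 - 1 * a) (1 * b - 0 * 0) (0 * a - 0 * b)]>%VS).
    apply: (center_line_pair W_unit eS uS); last by move=> *; ring.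
    by rewrite /nonzero3 !(mul0r, mulr0, mul1r, subr0) b0 orbT.
  apply: vline_eq => //; try (rewrite ?z0; ring).
    by rewrite /nonzero3 !(mul0r, mulr0, mul1r, subr0) b0 orbT.
  by rewrite z0 in e1 e2; lra.
Qed.

(** * The inconic: tangency, center and uniqueness *)

(** The form X^2 + Y^2 + Z^2 - 2 (YZ + ZX + XY) is multiplied by (pqr)^2 to clear the
    denominators. *)
Definition inconic_mx : 'M[R]_(2 + 1) :=
  frame_form W (sym3 ((q * r) ^+ 2) ((p * r) ^+ 2) ((p * q) ^+ 2)
    (- (p * r * (p * q))) (- (q * r * (p * q))) (- (q * r * (p * r)))).

Let inconic_sym3 := frame_formK W_unit (sym3 ((q * r) ^+ 2) ((p * r) ^+ 2)
  ((p * q) ^+ 2) (- (p * r * (p * q))) (- (q * r * (p * q)))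
  (- (q * r * (p * r)))).

Lemma mem_inconic_mx x y z : nonzero3 x y z ->
  conic_points inconic_mx <[vec x y z]>%VS <->
  (q * r * x) ^+ 2 + (p * r * y) ^+ 2 + (p * q * z) ^+ 2 =
  2 * ((p * r * y) * (p * q * z) + (q * r * x) * (p * q * z)
       + (q * r * x) * (p * r * y)).
Proof.
move=> h; rewrite (mem_conic W_unit inconic_sym3 h).
by split=> e; lra.
Qed.

Lemma inconic_unit : inconic_mx \in unitmx.
Proof.
rewrite (conic_unitmx W_unit inconic_sym3).
rewrite (_ : det3 _ _ _ _ _ _ = - 4 * (p * q * r) ^+ 4); last by rewrite /det3; ring.
by rewrite mulf_neq0 ?expf_neq0 ?mulf_neq0 // oppr_eq0 Num.Theory.pnatr_eq0.
Qed.

(** On each side the form is a perfect square; on BC it is (p (r y - q z))^2, which vanishes only at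
    the trace. *)
Lemma tangent_BC : tangent_at (conic_points inconic_mx) (line_through B C)
  (trace A B C P).
Proof.
rewrite /tangent_at (line_BC ABC) trace_A //.
have n : nonzero3 0 q r by rewrite /nonzero3 q0 orbT.
apply/seteqP; split=> [X [XI Xl]|X ->] /=; last first.
  split; last by rewrite /= -memvE mem_bary_line //; apply/eqP; ring.
  by apply/mem_inconic_mx => //; ring.
have [X1 _] := XI; have [x [y [z [h e]]]] := is_pointP W_unit X1; subst X.
move: Xl XI; rewrite /= -memvE mem_bary_line // mem_inconic_mx // => /eqP x0.
have e0 : x = 0 by lra.
subst x; move=> e; have : (p * (r * y - q * z)) ^+ 2 = 0 by lra.
move/eqP; rewrite expf_eq0 /= mulf_eq0 (negPf p0) /= => /eqP e'.
by apply: vline_eq => //; lra.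
Qed.

Lemma tangent_CA : tangent_at (conic_points inconic_mx) (line_through C A)
  (trace B C A P).
Proof.
rewrite /tangent_at (line_CA ABC) trace_B //.
have n : nonzero3 p 0 r by rewrite /nonzero3 p0.
apply/seteqP; split=> [X [XI Xl]|X ->] /=; last first.
  split; last by rewrite /= -memvE mem_bary_line //; apply/eqP; ring.
  by apply/mem_inconic_mx => //; ring.
have [X1 _] := XI; have [x [y [z [h e]]]] := is_pointP W_unit X1; subst X.
move: Xl XI; rewrite /= -memvE mem_bary_line // mem_inconic_mx // => /eqP y0.
have e0 : y = 0 by lra.
subst y; move=> e; have : (q * (r * x - p * z)) ^+ 2 = 0 by lra.
move/eqP; rewrite expf_eq0 /= mulf_eq0 (negPf q0) /= => /eqP e'.
by apply: vline_eq => //; lra.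
Qed.

Lemma tangent_AB : tangent_at (conic_points inconic_mx) (line_through A B)
  (trace C A B P).
Proof.
rewrite /tangent_at (line_AB ABC) trace_C //.
have n : nonzero3 p q 0 by rewrite /nonzero3 p0.
apply/seteqP; split=> [X [XI Xl]|X ->] /=; last first.
  split; last by rewrite /= -memvE mem_bary_line //; apply/eqP; ring.
  by apply/mem_inconic_mx => //; ring.
have [X1 _] := XI; have [x [y [z [h e]]]] := is_pointP W_unit X1; subst X.
move: Xl XI; rewrite /= -memvE mem_bary_line // mem_inconic_mx // => /eqP z0.
have e0 : z = 0 by lra.
subst z; move=> e; have : (r * (q * x - p * y)) ^+ 2 = 0 by lra.
move/eqP; rewrite expf_eq0 /= mulf_eq0 (negPf r0) /= => /eqP e'.
by apply: vline_eq => //; lra.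
Qed.

Lemma inconic_center :
  is_center inconic_mx (act (complement A B C) (isotomic A B C P)).
Proof.
left; split; first exact: inconic_unit.
rewrite complement_isotomic // (line_inf_bary ABC).
(* This constant is the common value of the three coordinates of the polar of Q. *)
apply: (pole_inf W_unit inconic_sym3 (k := - 2 * (p * q * r) ^+ 2)); try ring.
  by rewrite /nonzero3 mulf_neq0.
by rewrite !mulf_neq0 // ?expf_neq0 ?mulf_neq0 // oppr_eq0 Num.Theory.pnatr_eq0.
Qed.

Lemma is_inconic_mx :
  is_inconic A B C (act (complement A B C) (isotomic A B C P))
    (trace A B C P) (trace B C A P) (trace C A B P) (conic_points inconic_mx).
Proof.
split; last by split; [exact: tangent_BC|exact: tangent_CA|exact: tangent_AB].
exists inconic_mx; split=> //; last exact: inconic_center.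
  split; last exact: conic_sym W_unit _ _ _ _ _ _ _ inconic_sym3.
  apply: contraTneq inconic_unit => ->; rewrite unitmxE det0 unitr0 //.
exact: inconic_unit.
Qed.

(** Tangency leaves the form a single zero on each side, so [double_root], applied on the three
    sides, expresses every entry of the matrix through [g00]. *)
Lemma inconic_unique (I : set (subspace R)) :
  is_inconic A B C (act (complement A B C) (isotomic A B C P))
    (trace A B C P) (trace B C A P) (trace C A B P) I ->
  I = conic_points inconic_mx.
Proof.
move=> [[S [[_ sS] _ -> _]] []].
have [g00 [g11 [g22 [g12 [g02 [g01 eS]]]]]] : exists g00 g11 g22 g12 g02 g01,
    W *m S *m W^T = sym3 g00 g11 g22 g12 g02 g01.
  by apply: sym3P; rewrite !trmx_mul trmxK sS mulmxA.
rewrite /tangent_at (line_BC ABC) (line_CA ABC) (line_AB ABC).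
rewrite trace_A // trace_B // trace_C // => /seteqP [tA DA] /seteqP [tB DB].
move=> /seteqP [tC DC].
have [_ eh1 ef1] : [/\ g11 != 0, g12 = - g11 * q / r & g22 = g11 * (q / r) ^+ 2].
  apply: double_root => // [|y z yz e].
    have [+ _] := DA _ erefl; rewrite (mem_conic W_unit eS) => [e|].
      by rewrite -[RHS]e; ring.
    by rewrite /nonzero3 q0 orbT.
  have n : nonzero3 0 y z by rewrite /nonzero3 yz orbT.
  have [|k [_ -> ->]] := vline_inj W_unit (tA <[vec 0 y z]>%VS _); last by ring.
  split; last by rewrite /= -memvE mem_bary_line //; apply/eqP; ring.
  by apply/(mem_conic W_unit eS n); rewrite -[RHS]e; ring.
have [_ eh2 ef2] : [/\ g00 != 0, g02 = - g00 * p / r & g22 = g00 * (p / r) ^+ 2].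
  apply: double_root => // [|y z yz e].
    have [+ _] := DB _ erefl; rewrite (mem_conic W_unit eS) => [e|].
      by rewrite -[RHS]e; ring.
    by rewrite /nonzero3 p0.
  have n : nonzero3 y 0 z by rewrite /nonzero3 eqxx.
  have [|k [-> _ ->]] := vline_inj W_unit (tB <[vec y 0 z]>%VS _); last by ring.
  split; last by rewrite /= -memvE mem_bary_line //; apply/eqP; ring.
  by apply/(mem_conic W_unit eS n); rewrite -[RHS]e; ring.
have [g0 eh3 ef3] : [/\ g00 != 0, g01 = - g00 * p / q & g11 = g00 * (p / q) ^+ 2].
  apply: double_root => // [|y z yz e].
    have [+ _] := DC _ erefl; rewrite (mem_conic W_unit eS) => [e|].
      by rewrite -[RHS]e; ring.
    by rewrite /nonzero3 p0.
  have n : nonzero3 y z 0 by rewrite /nonzero3 eqxx orbF.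
  have [|k [-> -> _]] := vline_inj W_unit (tC <[vec y z 0]>%VS _); last by ring.
  split; last by rewrite /= -memvE mem_bary_line //; apply/eqP; ring.
  by apply/(mem_conic W_unit eS n); rewrite -[RHS]e; ring.
have form x y z : nonzero3 x y z ->
    conic_points S <[vec x y z]>%VS <-> conic_points inconic_mx <[vec x y z]>%VS.
  move=> h; rewrite (mem_conic W_unit eS h) (mem_conic W_unit inconic_sym3 h).
  (* The ratio of the two forms is read off from their x^2 coefficients. *)
  have k0 : g00 / (q * r) ^+ 2 != 0.
    by rewrite mulf_neq0 ?invr_eq0 ?expf_neq0 ?mulf_neq0.
  set f := (X in _ <-> X = 0).
  rewrite (_ : _ + _ = g00 / (q * r) ^+ 2 * f).
    split=> [/eqP|->]; last by rewrite mulr0.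
    by rewrite mulf_eq0 (negPf k0) => /eqP.
  by rewrite /f eh1 ef2 eh2 eh3 ef3; field; rewrite q0 r0.
apply/seteqP; split=> X XI; have [X1 _] := XI;
  have [x [y [z [h e]]]] := is_pointP W_unit X1; subst X; exact/(form _ _ _ h).
Qed.

(** * The affine maps [T] and [T'] in barycentric coordinates *)

Section CevianMap.
Context (T : affmap R).
Hypothesis TA : act T (pt A) = trace A B C P.
Hypothesis TB : act T (pt B) = trace B C A P.
Hypothesis TC : act T (pt C) = trace C A B P.

(** The images of [A], [B], [C] are the traces with coordinates divided by their sums, and an affine
    map is linear in normalized coordinates. *)
Lemma cevian_map_bary x y z :
  vec x y z *m aff_mx T =
  vec (p * (y / (p + r) + z / (p + q))) (q * (x / (q + r) + z / (p + q)))
    (r * (x / (q + r) + y / (p + r))).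
Proof.
move: TA TB TC; rewrite trace_A // trace_B // trace_C //.
rewrite (pt_A A B C) (pt_B A B C) (pt_C A B C).
move=> /act_normalized eA /act_normalized eB /act_normalized eC.
rewrite (vec_aff _ _ _ (eA _) (eB _) (eC _)); try by ring.
by apply: bary_eq; rewrite !(add0r, addr0) !mul0r; ring.
Qed.

Lemma cevian_map_unit : aff_mx T \in unitmx.
Proof.
apply: surj_unitmx => u; have [x [y [z ->]]] := vecP W_unit u.
(* Divided by q + r, p + r and p + q, the unknowns have the pairwise sums x / p, y / q and z / r;
   half-sums recover them. *)
exists (vec ((q + r) / 2 * (y / q + z / r - x / p))
            ((p + r) / 2 * (z / r + x / p - y / q))
            ((p + q) / 2 * (x / p + y / q - z / r))).
by rewrite cevian_map_bary; apply: bary_eq;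
  field; rewrite ?p0 ?q0 ?r0 ?qr0 ?pr0 ?pq0.
Qed.
End CevianMap.

Section IsotomicMap.
Context (T : affmap R).
Hypothesis TA : act T (pt A) = refl_trace A B C P.
Hypothesis TB : act T (pt B) = refl_trace B C A P.
Hypothesis TC : act T (pt C) = refl_trace C A B P.

Lemma isotomic_map_bary x y z :
  vec x y z *m aff_mx T =
  vec (r * y / (p + r) + q * z / (p + q)) (r * x / (q + r) + p * z / (p + q))
    (q * x / (q + r) + p * y / (p + r)).
Proof.
move: TA TB TC; rewrite refl_trace_A // refl_trace_B // refl_trace_C //.
rewrite (pt_A A B C) (pt_B A B C) (pt_C A B C).
move=> /act_normalized eA /act_normalized eB /act_normalized eC.
rewrite (vec_aff _ _ _ (eA _) (eB _) (eC _)); try by ring.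
by apply: bary_eq; rewrite !(add0r, addr0) !mul0r 1?[r + q]addrC
  1?[r + p]addrC 1?[q + p]addrC; ring.
Qed.

Lemma isotomic_map_unit : aff_mx T \in unitmx.
Proof.
apply: surj_unitmx => u; have [x [y [z ->]]] := vecP W_unit u.
(* If X is the first unknown divided by q + r, then q y + r z - p x = 2 q r X; the other two are
   analogous. *)
exists (vec ((q + r) * (q * y + r * z - p * x) / (2 * q * r))
            ((p + r) * (r * z + p * x - q * y) / (2 * p * r))
            ((p + q) * (p * x + q * y - r * z) / (2 * p * q))).
by rewrite isotomic_map_bary; apply: bary_eq;
  field; rewrite ?p0 ?q0 ?r0 ?qr0 ?pr0 ?pq0.
Qed.
End IsotomicMap.

(** * The map [M] and the image of the conic *)

Context (T T' : affmap R).
Hypothesis TA : act T (pt A) = trace A B C P.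
Hypothesis TB : act T (pt B) = trace B C A P.
Hypothesis TC : act T (pt C) = trace C A B P.
Hypothesis T'A : act T' (pt A) = refl_trace A B C P.
Hypothesis T'B : act T' (pt B) = refl_trace B C A P.
Hypothesis T'C : act T' (pt C) = refl_trace C A B P.

Local Notation M :=
  (aff_comp T (aff_comp (aff_inv (complement A B C)) T')).

(** Vectors of coordinate sum 0 are the directions of the plane, so this determines the linear part
    of [M]. *)
Lemma bary_sum0_M x y z : x + y + z = 0 ->
  vec x y z *m aff_mx M =
  (- (4 * p * q * r) / ((q + r) * (p + r) * (p + q))) *: vec x y z.
Proof.
move=> s; have -> : z = - x - y by lra.
rewrite !aff_mx_comp !mulmxA (isotomic_map_bary T'A T'B T'C) vec_inv_complement.
rewrite (cevian_map_bary TA TB TC) vecZ.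
by apply: bary_eq;
  field; rewrite ?p0 ?q0 ?r0 ?qr0 ?pr0 ?pq0.
Qed.

Lemma homothety_or_translation : is_homothety M \/ is_translation M.
Proof.
set k := - (4 * p * q * r) / ((q + r) * (p + r) * (p + q)).
have k0 : k != 0.
  by rewrite /k mulf_neq0 ?invr_eq0 ?oppr_eq0 ?mulf_neq0 // Num.Theory.pnatr_eq0.
(* The vector [row_mx v 0] is at infinity, so its barycentric coordinates add up to 0. *)
have linM : lin M = k%:M.
  apply/row_matrixP => i; rewrite !rowE; move: (delta_mx _ _) => v.
  have [x [y [z e]]] := vecP W_unit (row_mx v 0).
  have s : x + y + z = 0.
    move: e; rewrite vec_row_mx => /eq_row_mx [_ /matrixP /(_ 0 0)].
    by rewrite !mxE mulr1n.
  have := bary_sum0_M s; rewrite -e row_mx_aff scale_row_mx => /eq_row_mx [+ _].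
  by rewrite mul0mx addr0 mul_mx_scalar.
have eM : M = Affmap (lin M) (trans M) by [].
rewrite eM linM; move: (trans M) => t.
have [k1|k1] := eqVneq k 1; [right|left].
  by exists t; rewrite k1.
(* The center is the fixed point of X -> k X + t. *)
exists ((1 - k)^-1 *: t), k; split=> //; rewrite /homothety scalerA divff ?scale1r //.
by rewrite subr_eq0 eq_sym.
Qed.

Local Notation Kinv := (aff_inv (complement A B C)).

Lemma inv_complement_unit : aff_mx Kinv \in unitmx.
Proof.
apply: surj_unitmx => u; have [x [y [z ->]]] := vecP W_unit u.
exists (vec ((y + z) / 2) ((z + x) / 2) ((x + y) / 2)).
by rewrite vec_inv_complement; apply: bary_eq; field.
Qed.

(** The conic to be mapped is the preimage of the nine-point conic under [T'], so [T'] cancels in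
    its image under [M], and only T K^-1, with matrix [F], has to be studied. *)
Let F := aff_mx Kinv *m aff_mx T.

Lemma inconic_map_unit : F \in unitmx.
Proof. by rewrite unitmx_mul inv_complement_unit (cevian_map_unit TA TB TC). Qed.

Lemma mem_image_conic u : u != 0 ->
  conic_points nine_point_mx <[u]>%VS <->
  conic_points inconic_mx <[u *m F]>%VS.
Proof.
have [x [y [z ->]]] := vecP W_unit u; rewrite vec_eq0 // negbK => h.
have : vec x y z *m F != 0.
  apply: contraTneq h => e; have := mulmxK inconic_map_unit (vec x y z).
  by rewrite e mul0mx => /esym /eqP; rewrite vec_eq0.
rewrite /F mulmxA vec_inv_complement (cevian_map_bary TA TB TC).
rewrite vec_eq0 // negbK => h'.
rewrite (mem_nine_point_mx h) (mem_conic W_unit inconic_sym3 h').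
set f := (X in X = 0 <-> _).
(* After [F], X = V + W, Y = W + U and Z = U + V, where U = (y + z - x) / (q + r), V = (z + x - y) /
   (p + r), W = (x + y - z) / (p + q). The inconic form is then (pqr)^2 times -4 (UV + VW + WU),
   whence this factor. *)
have k0 : - 8 * (p * q * r) ^+ 2 / ((q + r) * (p + r) * (p + q)) != 0.
  by rewrite !mulf_neq0 ?invr_eq0 ?mulf_neq0 // oppr_eq0 Num.Theory.pnatr_eq0.
rewrite (_ : _ + _ = - 8 * (p * q * r) ^+ 2 / ((q + r) * (p + r) * (p + q)) * f).
  split=> [->|/eqP]; first by rewrite mulr0.
  by rewrite mulf_eq0 (negPf k0) => /eqP.
by rewrite /f; field; rewrite ?qr0 ?pr0 ?pq0.
Qed.

Lemma image_nine_point :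
  act (aff_comp T (aff_comp Kinv T')) @`
    (act T' @^-1` nine_point_conic A B C (isotomic A B C P)) =
  conic_points inconic_mx.
Proof.
have T'_unit := isotomic_map_unit T'A T'B T'C.
apply/seteqP; split=> [_ [Y YN <-]|X XI].
  have /nine_point_conic_sub N := YN.
  have [N1 _] := N; have [x [y [z [h e]]]] := is_pointP W_unit N1.
  rewrite !act_comp e !act_vline -mulmxA -/F; apply/mem_image_conic.
    by rewrite vec_eq0 // negbK.
  by rewrite -e.
have [X1 _] := XI; have [x [y [z [h e]]]] := is_pointP W_unit X1; subst X.
(* A preimage of a point of the inconic is found by undoing [F], which lands on the nine-point
   conic, and then [T']. *)
pose u := vec x y z *m invmx F.
have uF : u *m F = vec x y z by rewrite mulmxKV ?inconic_map_unit.
exists <[u *m invmx (aff_mx T')]>%VS; last first.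
  by rewrite !act_comp !act_vline mulmxKV // -mulmxA -/F uF.
rewrite /= act_vline mulmxKV //.
apply: sub_nine_point_conic => //; apply/mem_image_conic; last by rewrite uF.
apply: contraTneq h => e; have := uF; rewrite e mul0mx => /esym /eqP.
by rewrite vec_eq0.
Qed.

End Configuration.

Theorem theorem3p4 (R : realType) (A B C : 'rV[R]_2) (P : subspace R)
    (TP TP' : affmap R)
    (hABC : triangle A B C)
    (hP : is_point P)
    (hPsides : off_sides A B C P)
    (hPanti : off_anticomplementary_sides A B C P)
    (hTP : [/\ act TP (pt A) = trace A B C P,
               act TP (pt B) = trace B C A P &
               act TP (pt C) = trace C A B P])
    (hTP' : [/\ act TP' (pt A) = refl_trace A B C P,
                act TP' (pt B) = refl_trace B C A P &
                act TP' (pt C) = refl_trace C A B P]) :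
  let K := complement A B C in
  let P' := isotomic A B C P in
  let Q := act K P' in
  let C_O := act TP' @^-1` nine_point_conic A B C P' in
  let M := aff_comp TP (aff_comp (aff_inv K) TP') in
  (is_homothety M \/ is_translation M) /\
  exists I : set (subspace R),
    [/\ is_inconic A B C Q (trace A B C P) (trace B C A P) (trace C A B P) I,
        (forall I', is_inconic A B C Q (trace A B C P) (trace B C A P)
                      (trace C A B P) I' -> I' = I) &
        act M @` C_O = I].
Proof.
(* Ordinary and infinite [P] are treated alike: at infinity the coordinates add up to 0. *)
have [x [y [z [_ eP]]]] := is_pointP (triangle_frame_unit hABC) hP.
subst P; have [x0 y0 z0] := off_sides_coords hABC hPsides.
have [yz0 xz0 xy0] := off_anticomplementary_coords hABC hPanti.
case: hTP => TA TB TC; case: hTP' => T'A T'B T'C.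
move=> K P' Q C_O M; split.
  exact: (homothety_or_translation hABC x0 y0 z0 yz0 xz0 xy0 TA TB TC T'A).
exists (conic_points (inconic_mx A B C x y z)); split.
- exact: is_inconic_mx.
- by move=> I'; apply: inconic_unique.
- exact: (image_nine_point hABC x0 y0 z0 yz0 xz0 xy0 TA TB TC T'A).
Qed.
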